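(* Let $T$ and $B$ be lattice paths with steps $N=(0,1)$ and $E=(1,0)$ from the origin to $(x,y)\in\mathbb N^2$, with $T$ weakly above $B$. For any set $\mathcal D\subset\mathbb N$ and any finite sequence $\mathbf H$ of integers, the joint distribution of $(t,b)$ over $\widetilde{\mathcal P}(T,B,\mathcal D,\mathbf H)$ is symmetric, i.e. $$\sum_{P\in\widetilde{\mathcal P}(T,B,\mathcal D,\mathbf H)}u^{t(P)}v^{b(P)}=\sum_{P\in\widetilde{\mathcal P}(T,B,\mathcal D,\mathbf H)}u^{b(P)}v^{t(P)}.$$
   Context: $T$ weakly above $B$ means no point of $T$ is strictly below or strictly to the right of $B$. $\widetilde{\mathcal P}(T,B)$ is the set of self-avoiding lattice paths from the origin to $(x,y)$ with steps $N=(0,1)$, $E=(1,0)$ and $S=(0,-1)$ lying weakly below $T$ and weakly above $B$. The descent set of such a path is the set of $x$-coordinates at which its south steps occur. A top contact of $P$ is an east step of $P$ that is also a step of $T$, a bottom contact is an east step of $P$ that is also a step of $B$; $t(P)$ and $b(P)$ denote their numbers. $\widetilde{\mathcal P}(T,B,\mathcal D,\mathbf H)$ is the set of $P\in\widetilde{\mathcal P}(T,B)$ with descent set $\mathcal D$ and whose sequence (from left to right) of $y$-coordinates of the east steps that are neither top nor bottom contacts equals $\mathbf H$. *)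

(* Defs.v *)
From HB Require Import structures.
From mathcomp Require Import all_boot all_order all_algebra.
From mathcomp Require Import boolp classical_sets functions cardinality fsbigop.
From mathcomp Require Import zify.

Set Implicit Arguments.
Unset Strict Implicit.
Unset Printing Implicit Defensive.

Import Order.TTheory GRing.Theory Num.Theory.

Local Open Scope classical_set_scope.
Local Open Scope ring_scope.

Inductive step := North | East | South.

Definition step_code (s : step) : option bool :=
  match s with North => Some true | East => None | South => Some false end.
Definition step_decode (o : option bool) : step :=
  match o with Some true => North | None => East | Some false => South end.
Lemma step_codeK : cancel step_code step_decode. Proof. by case. Qed.
HB.instance Definition _ := Finite.copy step (can_type step_codeK).

(* No step goes west, so x-coordinates stay natural numbers; south steps
   may make y-coordinates negative. *)
Definition point : Type := (nat * int)%type.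
Definition origin : point := (0%N, 0).

Definition move (p : point) (s : step) : point :=
  match s with
  | North => (p.1, p.2 + 1)
  | East => (p.1.+1, p.2)
  | South => (p.1, p.2 - 1)
  end.

(* A path starting at the origin is the sequence of its steps. *)
Definition lpath := seq step.

Definition vertices (P : lpath) : seq point := origin :: scanl move origin P.

Definition endpoint (P : lpath) : point := last origin (vertices P).

(* The steps of P in order, each with its starting vertex; [zip] drops the
   final vertex. *)
Definition edges (P : lpath) : seq (point * step) := zip (vertices P) P.

Definition NE_path_to (x : nat) (y : int) (P : lpath) : bool :=
  (South \notin P) && (endpoint P == (x, y)).

(* p is strictly below Q when the vertical line through p meets Q, and does so
   only above p; similarly for the three other directions. *)
Definition strictly_below (p : point) (Q : lpath) : bool :=
  has (fun q => q.1 == p.1) (vertices Q) &&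
  all (fun q => (q.1 == p.1) ==> (p.2 < q.2)) (vertices Q).
Definition strictly_above (p : point) (Q : lpath) : bool :=
  has (fun q => q.1 == p.1) (vertices Q) &&
  all (fun q => (q.1 == p.1) ==> (q.2 < p.2)) (vertices Q).
Definition strictly_right (p : point) (Q : lpath) : bool :=
  has (fun q => q.2 == p.2) (vertices Q) &&
  all (fun q => (q.2 == p.2) ==> (q.1 < p.1)%N) (vertices Q).
Definition strictly_left (p : point) (Q : lpath) : bool :=
  has (fun q => q.2 == p.2) (vertices Q) &&
  all (fun q => (q.2 == p.2) ==> (p.1 < q.1)%N) (vertices Q).

Definition weakly_above (P Q : lpath) : bool :=
  all (fun p => ~~ strictly_below p Q && ~~ strictly_right p Q) (vertices P).

(* The mirror image of [weakly_above], and not [weakly_above Q P]: when P has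
   south steps, it is the points of P that are to be compared with the
   monotone path Q. *)
Definition weakly_below (P Q : lpath) : bool :=
  all (fun p => ~~ strictly_above p Q && ~~ strictly_left p Q) (vertices P).

Definition self_avoiding (P : lpath) : bool := uniq (vertices P).

Definition paths_between (x : nat) (y : int) (T B : lpath) : set lpath :=
  [set P | [&& self_avoiding P, endpoint P == (x, y),
               weakly_below P T & weakly_above P B]].

Definition descent_set (P : lpath) : set nat :=
  [set d | exists2 e, e \in edges P & e.2 = South /\ e.1.1 = d].

Definition is_contact (Q : lpath) (e : point * step) : bool :=
  (e.2 == East) && (e \in edges Q).

Definition contacts (Q P : lpath) : nat := count (is_contact Q) (edges P).

Definition top_contacts (T P : lpath) : nat := contacts T P.
Definition bottom_contacts (B P : lpath) : nat := contacts B P.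

Definition noncontact_heights (T B P : lpath) : seq int :=
  [seq e.1.2 | e <- edges P
             & [&& e.2 == East, ~~ is_contact T e & ~~ is_contact B e]].

Definition refined_paths (x : nat) (y : int) (T B : lpath)
    (D : set nat) (H : seq int) : set lpath :=
  [set P | [/\ paths_between x y T B P,
               descent_set P = D & noncontact_heights T B P = H]].

(* Sums over a set [\sum_(P \in A) F P] are 0 by convention when infinitely
   many terms are nonzero; the next lemmas show that the sets of paths
   considered here are finite. *)

Lemma scanl_x_monotone (P : lpath) (p q : point) :
  q \in p :: scanl move p P ->
  (p.1 <= q.1 <= (last p (scanl move p P)).1)%N.
Proof.
elim: P p q => [|s P IH] p q /=.
  by rewrite inE => /eqP ->; rewrite leqnn.
have ps : (p.1 <= (move p s).1)%N by case: s => /=.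
rewrite inE => /orP[/eqP -> | /IH /andP[]]; last by lia.
have := IH (move p s) (move p s) (mem_head _ _); lia.
Qed.

Lemma scanl_meets_column (P : lpath) (p : point) (a : nat) :
  (p.1 <= a <= (last p (scanl move p P)).1)%N ->
  exists2 q, q \in p :: scanl move p P & q.1 = a.
Proof.
elim: P p => [|s P IH] p /=.
  by move=> h; exists p; rewrite ?mem_head //; lia.
move=> h; have [pa|pa] := eqVneq p.1 a; first by exists p; rewrite ?mem_head.
have [|q qP qa] := IH (move p s); first by case: s h => /=; lia.
by exists q => //; rewrite inE qP orbT.
Qed.

Lemma scanl_NE_y_monotone (P : lpath) (p q : point) :
  South \notin P -> q \in p :: scanl move p P ->
  p.2 <= q.2 <= (last p (scanl move p P)).2.
Proof.
elim: P p q => [|s P IH] p q /=.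
  by rewrite inE => _ /eqP ->; rewrite lexx.
rewrite [South \in _]inE negb_or => /andP[sS NP].
have ps : p.2 <= (move p s).2 by case: s sS => //= _; lia.
rewrite inE => /orP[/eqP -> | /(IH _ _ NP)]; last by lia.
have := IH (move p s) (move p s) NP (mem_head _ _); lia.
Qed.

Lemma paths_between_in_box (x y : nat) (T B P : lpath) :
  NE_path_to x y T -> NE_path_to x y B -> paths_between x y T B P ->
  {subset vertices P <= [seq (i, j%:Z) | i <- iota 0 x.+1, j <- iota 0 y.+1]}.
Proof.
move=> /andP[NT /eqP eT] /andP[NB /eqP eB].
move=> /and4P[_ /eqP eP /allP PT /allP PB] p pP.
have px : (p.1 <= x)%N.
  by have := scanl_x_monotone pP; rewrite -[last _ _]/(endpoint P) eP => /andP[].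
have col Q : endpoint Q = (x, y%:Z) -> has (fun q => q.1 == p.1) (vertices Q).
  move=> eQ; have [|q qQ qp] := @scanl_meets_column Q origin p.1.
    by rewrite -[last _ _]/(endpoint Q) eQ.
  by apply/hasP; exists q => //; apply/eqP.
have p0 : 0 <= p.2.
  have /andP[+ _] := PB _ pP; rewrite /strictly_below (col B eB) andTb.
  case/allPn => q qB; rewrite negb_imply => /andP[_].
  by have /andP[+ _] := scanl_NE_y_monotone NB qB; rewrite /=; lia.
have py : p.2 <= y%:Z.
  have /andP[+ _] := PT _ pP; rewrite /strictly_above (col T eT) andTb.
  case/allPn => q qT; rewrite negb_imply => /andP[_].
  have /andP[_] := scanl_NE_y_monotone NT qT.
  by rewrite -[last _ _]/(endpoint T) eT /=; lia.
have -> : p = (p.1, `|p.2|%N%:Z) by case: p p0 {pP px col py} => a [].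
by apply: (allpairs_f (fun i j => (i, j%:Z))); rewrite mem_iota; lia.
Qed.

Lemma finite_paths_between (x y : nat) (T B : lpath) :
  NE_path_to x y T -> NE_path_to x y B -> finite_set (paths_between x y T B).
Proof.
move=> hT hB; set n := (x.+1 * y.+1)%N.
apply: (@sub_finite_set _ _ (range (fun P : n.-bseq step => P : lpath))).
  move=> P hP; have /and4P[uP _ _ _] := hP.
  have := uniq_leq_size uP (paths_between_in_box hT hB hP).
  rewrite size_allpairs !size_iota /= size_scanl => /ltnW szP.
  by exists (Bseq szP).
exact/finite_image/finite_finset.
Qed.

Lemma finite_refined_paths (x y : nat) (T B : lpath) (D : set nat)
    (H : seq int) :
  NE_path_to x y T -> NE_path_to x y B ->
  finite_set (refined_paths x y T B D H).
Proof.
move=> hT hB; apply: sub_finite_set (finite_paths_between hT hB).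
by move=> P [].
Qed.

(* Main.v *)
Require Import Defs.
From mathcomp Require Import all_boot all_order all_algebra.
From mathcomp Require Import boolp classical_sets functions cardinality fsbigop.
From mathcomp Require Import zify ring.

Set Implicit Arguments.
Unset Strict Implicit.
Unset Printing Implicit Defensive.

Import Order.TTheory GRing.Theory Num.Theory.

Local Open Scope classical_set_scope.
Local Open Scope ring_scope.

(* A self-avoiding path is determined by the heights of its east steps, and
   lies between [B] and [T] exactly when these heights lie between those of the
   two boundaries. The generating function of the suffixes of such height
   sequences satisfies a recursion on the first column. Since the descents and
   the non-descents from a given height add up to the whole generating function
   of the remaining columns, symmetry for a descent and for a non-descent are
   equivalent modulo symmetry for fewer columns. What remains is the symmetry of
   one auxiliary quantity, [exchange], which trades a contact in one column
   for a noncontact, and which reduces to itself one column further on. *)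

(** * Height sequences between the two boundaries *)

Section Fillings.
Variable y : int.
Implicit Types (cols : seq (int * int)) (q : pred int) (d : nat -> bool).

(* A column [(b, t)] holds the heights of the bottom and top boundaries.
   [fillings cols q d H] lists the height sequences within the boundaries whose
   first value satisfies [q] (the final ordinate [y] if [cols] is empty), whose
   descents are the [i] with [d i] (between column [i] and the next, where [y]
   follows the last column), and whose noncontact heights are [H]. *)
Fixpoint fillings cols q d (H : seq int) : seq (seq int) :=
  if cols is (b, t) :: cols' then
    let start w H' :=
      if q w then
        [seq w :: hs
        | hs <- fillings cols' (fun w' => (w' < w) == d 0%N) (d \o succn) H']
      else [::] in
    start t H ++
    if b == t then [::] else
      start b H ++
      if H is h :: H' then if b < h < t then start h H' else [::] else [::]
  else if [&& H == [::], q y & `[< forall i, d i = false >]] then [:: [::]]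
  else [::].

Definition matches (zs hs : seq int) : nat :=
  count (fun e => e.1 == e.2) (zip zs hs).

Definition noncontacts cols (hs : seq int) : seq int :=
  [seq e.2 | e <- zip cols hs & (e.2 != e.1.1) && (e.2 != e.1.2)].

(** The appended column [(y, y)] bounds both boundaries by the final ordinate and makes
    [head (y, y) cols] meaningful when no column is left. *)
Definition good_columns cols : Prop :=
  all (fun c => c.1 <= c.2) cols /\
  sorted (fun c c' => (c.1 <= c'.1) && (c.2 <= c'.2)) (rcons cols (y, y)).

Lemma good_columns_behead c cols : good_columns (c :: cols) -> good_columns cols.
Proof. by case=> /= /andP[_ ?] /path_sorted. Qed.

Lemma good_columns_cons c cols : good_columns (c :: cols) ->
  c.1 <= c.2 /\
  (c.1 <= (head (y, y) cols).1 /\ c.2 <= (head (y, y) cols).2).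
Proof.
by case=> /= /andP[-> _]; case: cols => [|c' cols] /= /andP[/andP[]].
Qed.

(** * The generating function by contacts and its symmetry *)

Section Weight.
Variables (R : comNzRingType).
Implicit Types u v : R.

Definition weight u v cols hs : R :=
  u ^+ matches (unzip2 cols) hs * v ^+ matches (unzip1 cols) hs.

Definition gf u v cols q d H : R :=
  \sum_(hs <- fillings cols q d H) weight u v cols hs.

Definition noncontact_gf u v b t cols q d H : R :=
  if H is h :: H' then
    if (b < h < t) && q h
    then gf u v cols (fun w => (w < h) == d 0%N) (d \o succn) H' else 0
  else 0.

(** Expansion on the first column: a noncontact has weight 1 and uses up the head of [H]; where the
    boundaries coincide, a contact counts as both top and bottom. *)
Lemma gf_cons u v b t cols q d H : gf u v ((b, t) :: cols) q d H =
  if b == t then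
    if q t then u * v * gf u v cols (fun w => (w < t) == d 0%N) (d \o succn) H
    else 0
  else
    (if q t then u * gf u v cols (fun w => (w < t) == d 0%N) (d \o succn) H
     else 0) +
    (if q b then v * gf u v cols (fun w => (w < b) == d 0%N) (d \o succn) H
     else 0) +
    noncontact_gf u v b t cols q d H.
Proof.
have step (w : int) H' : \sum_(hs <- [seq w :: hs | hs <- fillings cols
      (fun w' => (w' < w) == d 0%N) (d \o succn) H'])
      weight u v ((b, t) :: cols) hs =
    u ^+ (t == w) * v ^+ (b == w) *
    gf u v cols (fun w' => (w' < w) == d 0%N) (d \o succn) H'.
  rewrite big_map mulr_sumr; apply: eq_bigr => hs _ /=.
  by rewrite /weight /matches /= !exprD mulrACA.
rewrite {1}/gf /= !big_cat /=; case: (eqVneq b t) => [bt|bt].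
  rewrite big_nil addr0; case: ifP => _; last by rewrite big_nil.
  by rewrite step bt eqxx !expr1.
rewrite big_cat /= addrA; congr (_ + _ + _).
- case: ifP => _; last by rewrite big_nil.
  by rewrite step eqxx (negbTE bt) expr1 expr0 mulr1.
- case: ifP => _; last by rewrite big_nil.
  by rewrite step eqxx eq_sym (negbTE bt) expr1 expr0 mul1r.
- rewrite /noncontact_gf; case: H => [|h H]; first by rewrite big_nil.
  have [/andP[bh ht]|_] := boolP (b < h < t); last by rewrite big_nil.
  rewrite /=; case: ifP => _; last by rewrite big_nil.
  by rewrite step (gt_eqF ht) (lt_eqF bh) !expr0 !mul1r.
Qed.

Lemma gf_nil u v q d H : gf u v [::] q d H =
  ([&& H == [::], q y & `[< forall i, d i = false >]])%:R.
Proof.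
by rewrite /gf /=; case: ifP => _; rewrite ?big_nil // big_seq1 /weight !expr0 mulr1.
Qed.

(** The first height lies between the boundaries of the first column, so only the values of [q]
    there matter. *)
Lemma eq_gf u v cols q q' d H : good_columns cols ->
  (forall w, (head (y, y) cols).1 <= w -> w <= (head (y, y) cols).2 -> q w = q' w) ->
  gf u v cols q d H = gf u v cols q' d H.
Proof.
case: cols => [|[b t] cols] gc qq' /=; first by rewrite !gf_nil (qq' y).
have [/= bt _] := good_columns_cons gc.
rewrite !gf_cons /noncontact_gf (qq' t) // (qq' b) //; case: H => // h H.
have [/andP[bh ht]|//] := boolP (b < h < t); by rewrite (qq' h) //= ltW.
Qed.

Lemma gf_false u v cols q d H : good_columns cols ->
  (forall w, (head (y, y) cols).1 <= w -> w <= (head (y, y) cols).2 -> q w = false) ->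
  gf u v cols q d H = 0.
Proof.
move=> gc q0; rewrite (@eq_gf _ _ _ _ pred0) //.
case: cols {gc q0} => [|[b t] cols]; first by rewrite gf_nil /= andbF.
rewrite gf_cons /noncontact_gf /=; case: eqP => // _; rewrite !add0r.
by case: H => // h H; rewrite andbF.
Qed.

(** With [q] a descent condition, non-descents become the complement of descents in a sum
    independent of the preceding height. *)
Lemma gf_predC u v cols q d H :
  gf u v cols predT d H = gf u v cols q d H + gf u v cols (predC q) d H.
Proof.
case: cols => [|[b t] cols].
  by rewrite !gf_nil /=; case: (q y); case: (_ == _) => //=; rewrite ?addr0 ?add0r.
rewrite !gf_cons /noncontact_gf /=.
case: eqP => _; first by case: (q t); rewrite ?addr0 ?add0r.
case: H => [|h H]; last case: (b < h < t); last 1 first.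
all: case: (q t); case: (q b); rewrite /= ?addr0 ?add0r //; try exact: addrC.
all: case: (q h); rewrite /= ?addr0 ?add0r //; ring.
Qed.

Lemma gf_eqb u v cols q (e : bool) d H :
  gf u v cols (fun w => q w == e) d H =
  if e then gf u v cols q d H
  else gf u v cols predT d H - gf u v cols q d H.
Proof.
case: e.
  by congr (gf _ _ _ _ _ _); apply/funext => w; rewrite eqb_id.
rewrite (gf_predC _ _ _ q) addrC addKr.
by congr (gf _ _ _ _ _ _); apply/funext => w; rewrite eqbF_neg.
Qed.

(* If the first column of [cols] is [(b', t')] with [b <= b'] and [p <= t'],
   this is symmetric in [u] and [v]: expanding the first column, where a bottom
   contact contributes a multiple of [u * v], leaves the analogous expression
   for the next column with [p] replaced by the noncontact height [h]. *)
Definition exchange u v b p cols d H : R :=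
  u * gf u v cols (fun w => w < p) d H +
  if H is h :: H' then
    if b < h < p then gf u v cols (fun w => w < h) d H' else 0
  else 0.

Lemma gf_lt0 u v cols p d H : good_columns cols -> p <= (head (y, y) cols).1 ->
  gf u v cols (fun w => w < p) d H = 0.
Proof. by move=> gc pb; apply: gf_false => // w; lia. Qed.

(* The sum of the contributions of a top contact, a bottom contact and a
   noncontact preceding [cols], when [p] is the top boundary. *)
Definition exchange_eqb u v b p cols e d H : R :=
  u * gf u v cols (fun w => (w < p) == e) d H +
  v * gf u v cols (fun w => (w < b) == e) d H +
  if H is h :: H' then
    if b < h < p then gf u v cols (fun w => (w < h) == e) d H' else 0
  else 0.

Lemma gf_lt_eqb u v cols p e d H : good_columns cols -> p <= (head (y, y) cols).1 ->
  gf u v cols (fun w => (w < p) == e) d H =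
  if e then 0 else gf u v cols predT d H.
Proof. by move=> gc pb; rewrite gf_eqb gf_lt0 ?subr0. Qed.

(** A descent from [b] is impossible, so the [v] term is zero for [e] true and the full sum for [e]
    false. Complementing the other two terms produces [exchange] with a minus sign. *)
Lemma exchange_eqbE u v b p cols e d H :
  good_columns cols -> b <= (head (y, y) cols).1 ->
  exchange_eqb u v b p cols e d H =
  if e then exchange u v b p cols d H
  else (u + v) * gf u v cols predT d H +
    (if H is h :: H' then if b < h < p then gf u v cols predT d H' else 0 else 0) -
    exchange u v b p cols d H.
Proof.
move=> gc bb; rewrite /exchange_eqb /exchange (gf_lt_eqb _ _ _ _ _ gc bb) !gf_eqb.
case: H => [|h H]; last (rewrite gf_eqb; case: (b < h < p)); case: e; ring.
Qed.

(** Simultaneous induction on the columns: each claim rests on both claims for the remaining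
    columns. *)
Lemma gf_symmetric_and_exchange u v cols : good_columns cols ->
  (forall d H, gf u v cols predT d H = gf v u cols predT d H) /\
  (forall (b p : int) d H, b <= (head (y, y) cols).1 -> p <= (head (y, y) cols).2 ->
     exchange u v b p cols d H = exchange v u b p cols d H).
Proof.
elim: cols => [|[b t] cols IH] gc.
  split=> [d H|b p d H _ py]; first by rewrite !gf_nil.
  rewrite /exchange !gf_lt0 // !mulr0; case: H => // h H.
  by case: ifP => // ?; rewrite !gf_nil.
have gc' := good_columns_behead gc.
have [/= bt [bb' tt']] := good_columns_cons gc.
have {IH} [symA symX] := IH gc'.
(* Where the boundaries meet, no later height is below [t], and [p <= t] excludes a first height
   below [p]: all descent terms vanish. *)
have [btE|bnt] := eqVneq b t.
  subst t; split=> [d H|b0 p d H b0b pb].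
    by rewrite !gf_cons eqxx /= !gf_lt_eqb // symA [u * v]mulrC.
  rewrite /exchange !gf_lt0 // !mulr0; case: H => // h H.
  by case: ifP => // ?; rewrite !gf_lt0 //=; lia.
have ltbt : b < t by rewrite lt_neqAle bnt.
(* Descent and non-descent at once; used with [p] equal to [t] for the first claim and to a
   noncontact height for the second. *)
have symE (p : int) e d H : p <= t ->
    exchange_eqb u v b p cols e d H = exchange_eqb v u b p cols e d H.
  move=> pt; rewrite !exchange_eqbE // symX //; last exact: le_trans tt'.
  rewrite symA [u + v]addrC; case: H => // h H; by rewrite symA.
split=> [d H|b0 p d H b0b pt].
  move: (symE t (d 0%N) (d \o succn) H (lexx _)).
  rewrite /exchange_eqb !gf_cons (negbTE bnt) /= /noncontact_gf.
  by case: H => // h H; rewrite /predT andbT.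
(* A threshold [r <= t] excludes the top contact. *)
have gf_lt u1 v1 (r : int) K : r <= t -> gf u1 v1 ((b, t) :: cols) (fun w => w < r) d K =
    (if b < r then v1 * gf u1 v1 cols (fun w => (w < b) == d 0%N) (d \o succn) K else 0) +
    (if K is h :: K' then if b < h < r then
       gf u1 v1 cols (fun w => (w < h) == d 0%N) (d \o succn) K' else 0 else 0).
  move=> rt; rewrite gf_cons (negbTE bnt) /= ltNge rt /= add0r /noncontact_gf.
  by case: K => // h K; have -> : (b < h < t) && (h < r) = (b < h < r) by lia.
rewrite /exchange !gf_lt // !(gf_lt_eqb _ _ _ _ _ gc' bb') symA !mulrDr.
(* The bottom contact gives a multiple of [u * v], with a symmetric cofactor because no descent from
   [b] is possible. *)
have -> A : u * (if b < p then v * A else 0) = v * (if b < p then u * A else 0).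
  by case: ifP => _; rewrite ?mulr0 // mulrCA.
case: H => [|h H]; first by rewrite !mulr0.
(* Outside [b < h < p] everything left is zero: for [h <= b] no first height lies below [h]. *)
have [bhp|/negbTE bhp] := boolP (b < h < p); last first.
  rewrite !mulr0; case: (boolP (b0 < h < p)) => // b0hp.
  by rewrite !gf_lt0 //=; lia.
have -> : b0 < h < p by lia.
have bh : b < h by lia.
(* The first term, with [h] placed in this column, is the [u] term of [exchange_eqb] at [p = h]; the
   second, expanded by [gf_lt], supplies the other two. *)
have := symE h (d 0%N) (d \o succn) H; rewrite /exchange_eqb => /(_ ltac:(lia)) E.
have ht : h <= t by lia.
by rewrite !gf_lt // bh -!addrA; congr (_ + _); rewrite !addrA.
Qed.

(** The origin acts as a height [0] before the first column. The lower boundary is nonnegative, so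
    no descent occurs there. *)
Lemma gf_symmetric u v cols (e : bool) d H : good_columns cols ->
  0 <= (head (y, y) cols).1 ->
  gf u v cols (fun w => (w < 0) == e) d H = gf v u cols (fun w => (w < 0) == e) d H.
Proof.
move=> gc b0; have [symA _] := gf_symmetric_and_exchange u v gc.
by rewrite !gf_lt_eqb // symA.
Qed.

End Weight.

(** * Which height sequences [fillings] lists *)

Lemma mem_map_cons (w w0 : int) hs (L : seq (seq int)) :
  (w :: hs \in [seq w0 :: l | l <- L]) = (w == w0) && (hs \in L).
Proof.
apply/mapP/andP => [[l lL [-> ->]]|[/eqP -> hsL]]; first by rewrite eqxx.
by exists hs.
Qed.

(** The default [y] of [nth] puts the final ordinate after the last column, so a drop to it counts
    as a descent and [d] is false further on. The bound on [cols] keeps the contact heights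
    themselves within the boundaries. *)
Lemma mem_fillings cols q d H hs : all (fun c => c.1 <= c.2) cols ->
  hs \in fillings cols q d H <->
  [/\ size hs = size cols, all (fun e => e.1.1 <= e.2 <= e.1.2) (zip cols hs),
      q (head y hs), (forall i, d i = (nth y hs i.+1 < nth y hs i)) &
      noncontacts cols hs = H].
Proof.
elim: cols q d H hs => [|[b t] cols IH] q d H hs /=.
  move=> _; case: hs => [|w hs]; last by case: ifP => _; split=> // -[].
  case: and3P => [[/eqP -> qy /asboolP d0]|nH]; split=> //.
    by move=> _; split=> // i; rewrite d0 !nth_nil ltxx.
  case=> _ _ qy d0 ncE; case: nH; split=> //; first by rewrite -ncE.
  by apply/asboolP => i; rewrite d0 !nth_nil ltxx.
move=> /andP[bt gc].
case: hs => [|w hs].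
  have start_nil w0 L : [::] \in (if q w0 then [seq w0 :: l | l : seq int <- L] else [::]) = false.
    by case: (q w0) => //; apply/negbTE/mapP => -[].
  split=> [|[]//]; rewrite mem_cat start_nil /=.
  case: (b == t) => //; rewrite mem_cat start_nil.
  by case: H => // h H; case: (b < h < t); rewrite ?start_nil.
have mem_start w0 H' :
    (w :: hs \in if q w0 then
      [seq w0 :: hs | hs <- fillings cols (fun w' => (w' < w0) == d 0%N) (d \o succn) H']
      else [::]) = [&& w == w0, q w &
      hs \in fillings cols (fun w' => (w' < w) == d 0%N) (d \o succn) H'].
  case: (eqVneq w w0) => [->|ne]; first by case: (q w0) => //; rewrite mem_map_cons eqxx.
  by case: (q w0) => //; rewrite mem_map_cons (negbTE ne).
(* One test for the three branches: a contact leaves [H] unchanged, a noncontact must be its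
   head. *)
have memE : (w :: hs \in fillings ((b, t) :: cols) q d H) =
    [&& q w, b <= w <= t & if (w != b) && (w != t) then
      if H is h :: H' then (h == w) &&
      (hs \in fillings cols (fun w' => (w' < w) == d 0%N) (d \o succn) H') else false
      else hs \in fillings cols (fun w' => (w' < w) == d 0%N) (d \o succn) H].
  rewrite /= mem_cat mem_start; have [wt|wt] := eqVneq w t.
    subst t; rewrite bt lexx andbF /=; case: ifP => [_|/negbT bnt]; first by rewrite in_nil orbF.
    rewrite mem_cat mem_start [w == b]eq_sym (negbTE bnt) /=.
    case: H => [|h H]; first by rewrite orbF.
    case: ifP => [/andP[_ ht]|_]; last by rewrite orbF.
    by rewrite mem_start (gt_eqF ht) orbF.
  rewrite andbT /=; have [btE|bnt] := eqVneq b t.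
    subst t; have /negbTE -> : ~~ (b <= w <= b) by lia.
    by rewrite /= andbF.
  rewrite mem_cat mem_start; have [wb|wb] := eqVneq w b.
    subst b; rewrite bt lexx /=; case: H => [|h H]; first by rewrite orbF.
    case: ifP => [/andP[bh _]|_]; last by rewrite orbF.
    by rewrite mem_start (lt_eqF bh) orbF.
  rewrite /=; case: H => [|h H]; first by rewrite !andbF.
  have [bht|bht] := boolP (b < h < t).
    rewrite mem_start [h == w]eq_sym; case: (eqVneq w h) => [wh|]; last by rewrite !andbF.
    by rewrite wh; have -> : b <= h <= t by lia.
  have [hw|_] := eqVneq h w; last by rewrite !andbF.
  have /negbTE -> : ~~ (b <= w <= t) by lia.
  by rewrite /= andbF.
have -> : noncontacts ((b, t) :: cols) (w :: hs) =
    if (w != b) && (w != t) then w :: noncontacts cols hs else noncontacts cols hs.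
  by rewrite /noncontacts /=; case: ifP.
rewrite memE /=; split.
  case/and3P => qw bwt; case: ifP => wbt.
    case: H {memE} => // h H /andP[/eqP ->] /IH[]// sz al /eqP d0 dS nc.
    rewrite sz al bwt nc; split=> // -[|i]; last exact: dS.
    by rewrite -d0; case: (hs).
  move=> /IH[]// sz al /eqP d0 dS nc.
  rewrite sz al bwt nc; split=> // -[|i]; last exact: dS.
  by rewrite -d0; case: (hs).
case=> -[sz] /andP[bwt al] qw dE ncE; rewrite qw bwt /=.
have hsP H' : noncontacts cols hs = H' ->
    hs \in fillings cols (fun w' => (w' < w) == d 0%N) (d \o succn) H'.
  move=> nc; apply/IH => //; split=> // [|i]; last exact: dE.
  by rewrite dE /=; case: (hs).
by case: ifP ncE => _ ncE; [rewrite -ncE eqxx hsP|rewrite hsP].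
Qed.

(** The branches are disjoint: their first heights are [t], [b] and a value strictly between. *)
Lemma fillings_uniq cols q d H : uniq (fillings cols q d H).
Proof.
elim: cols q d H => [|[b t] cols IH] q d H /=; first by case: ifP.
have start_uniq w0 H' : uniq (if q w0 then
    [seq w0 :: hs | hs <- fillings cols (fun w' => (w' < w0) == d 0%N) (d \o succn) H']
    else [::]).
  by case: (q w0) => //; rewrite map_inj_uniq // => ? ? [].
have start_head w0 L hs : hs \in (if q w0 then [seq w0 :: l | l : seq int <- L] else [::]) ->
    ohead hs = Some w0.
  by case: (q w0) => // /mapP[? _ ->].
rewrite cat_uniq start_uniq; case: eqVneq => [//|bt].
rewrite cat_uniq start_uniq; apply/and3P; split=> //.
  apply/hasPn => hs; rewrite mem_cat => hsP; apply/negP => /start_head hst.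
  case/orP: hsP => [/start_head|]; first by rewrite hst => -[tb]; rewrite tb eqxx in bt.
  case: H => // h H; case: ifP => // bht /start_head; rewrite hst => -[th]; lia.
rewrite /=; apply/andP; split.
  apply/hasPn => hs hsP; apply/negP => /start_head hsb; move: hsP.
  case: H => // h H; case: ifP => // bht /start_head; rewrite hsb => -[th]; lia.
by case: H => // h H; case: ifP.
Qed.
End Fillings.

(** * Paths encoded by the heights of their east steps *)

Definition vertices_from (p : Defs.point) (P : lpath) : seq Defs.point :=
  p :: scanl move p P.

Definition edges_from (p : Defs.point) (P : lpath) : seq (Defs.point * step) :=
  zip (vertices_from p P) P.

Definition heights_from (p : Defs.point) (P : lpath) : seq int :=
  [seq e.1.2 | e <- edges_from p P & e.2 == East].

Definition vertical (a b : int) : lpath :=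
  if a <= b then nseq `|b - a| North else nseq `|b - a| South.

Section PathOfHeights.
Variable y : int.

Fixpoint path_of_heights (a : int) (hs : seq int) : lpath :=
  if hs is h :: hs' then vertical a h ++ East :: path_of_heights h hs'
  else vertical a y.

Lemma path_of_heights_nil : path_of_heights y [::] = [::].
Proof. by rewrite /= /vertical lexx subrr. Qed.

Lemma path_of_heights_East h hs :
  path_of_heights h (h :: hs) = East :: path_of_heights h hs.
Proof. by rewrite /= /vertical lexx subrr. Qed.

Lemma vertical_North (a b : int) : a < b -> vertical a b = North :: vertical (a + 1) b.
Proof.
move=> ab; rewrite /vertical ltW //; have -> : a + 1 <= b by lia.
by have -> : `|b - a|%N = `|(b - (a + 1))%R|%N.+1 by lia.
Qed.

Lemma vertical_South (a b : int) : b < a -> vertical a b = South :: vertical (a - 1) b.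
Proof.
move=> ba; rewrite /vertical leNgt ba /=.
have -> : `|b - a|%N = `|(b - (a - 1))%R|%N.+1 by lia.
case: leP => // ba1; by have -> : `|(b - (a - 1))%R|%N = 0%N by lia.
Qed.

Lemma path_of_heights_North (a : int) (hs : seq int) : a < head y hs ->
  path_of_heights a hs = North :: path_of_heights (a + 1) hs.
Proof. by case: hs => [|h hs] /= ab; rewrite vertical_North. Qed.

Lemma path_of_heights_South (a : int) (hs : seq int) : head y hs < a ->
  path_of_heights a hs = South :: path_of_heights (a - 1) hs.
Proof. by case: hs => [|h hs] /= ab; rewrite vertical_South. Qed.

(** Induction along single steps instead of the blocks [vertical]: one unit towards the next height,
    or east once it is reached. [Q] also carries the abscissa. *)
Lemma path_of_heights_ind (Q : nat -> int -> seq int -> lpath -> Prop) :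
  (forall c, Q c y [::] [::]) ->
  (forall c h hs, Q c.+1 h hs (path_of_heights h hs) ->
     Q c h (h :: hs) (East :: path_of_heights h hs)) ->
  (forall c a hs, a < head y hs -> Q c (a + 1) hs (path_of_heights (a + 1) hs) ->
     Q c a hs (North :: path_of_heights (a + 1) hs)) ->
  (forall c a hs, head y hs < a -> Q c (a - 1) hs (path_of_heights (a - 1) hs) ->
     Q c a hs (South :: path_of_heights (a - 1) hs)) ->
  forall c a hs, Q c a hs (path_of_heights a hs).
Proof.
move=> Qnil QE QN QS c a hs.
have vert c0 hs0 : Q c0 (head y hs0) hs0 (path_of_heights (head y hs0) hs0) ->
    forall b, Q c0 b hs0 (path_of_heights b hs0).
  (* Induction on the distance to the next height. *)
  move=> Q0 b; have [n] := ubnP `|(head y hs0 - b)%R|%N.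
  elim: n b => // n IH b nb.
  have [hb|hb|<- //] := ltgtP (head y hs0) b.
    by rewrite path_of_heights_South //; apply: QS => //; apply: IH; lia.
  by rewrite path_of_heights_North //; apply: QN => //; apply: IH; lia.
elim: hs c a => [|h hs IH] c a; apply: vert.
  by rewrite path_of_heights_nil.
by rewrite path_of_heights_East; apply: QE.
Qed.

Fixpoint east_edges (c : nat) (hs : seq int) : seq (Defs.point * step) :=
  if hs is h :: hs' then ((c, h), East) :: east_edges c.+1 hs' else [::].

Lemma east_edges_path_of_heights c a hs :
  [seq e <- edges_from (c, a) (path_of_heights a hs) | e.2 == East] =
  east_edges c hs.
Proof.
apply: (@path_of_heights_ind (fun c a hs P =>
  [seq e <- edges_from (c, a) P | e.2 == East] = east_edges c hs)) => //= {c a hs}.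
by move=> c h hs <-.
Qed.

Lemma heights_from_path_of_heights c a hs :
  heights_from (c, a) (path_of_heights a hs) = hs.
Proof.
rewrite /heights_from east_edges_path_of_heights.
by elim: hs c => //= h hs IH c; rewrite IH.
Qed.

Lemma last_path_of_heights c a hs :
  last (c, a) (scanl move (c, a) (path_of_heights a hs)) = ((c + size hs)%N, y).
Proof.
apply: (@path_of_heights_ind (fun c a hs P =>
  last (c, a) (scanl move (c, a) P) = ((c + size hs)%N, y))) => {c a hs} //=.
- by move=> c; rewrite addn0.
- by move=> c h hs ->; rewrite addnS.
Qed.

(** In column [i] the path runs monotonically from its entering height, at index [i - c] of
    [a :: hs], to its leaving height, at the next index or [y] past the end. *)
Lemma vertices_path_of_heights c a hs (i : nat) (z : int) :
  ((i, z) \in vertices_from (c, a) (path_of_heights a hs)) =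
  [&& (c <= i <= c + size hs)%N,
    Num.min (nth y (a :: hs) (i - c)) (nth y (a :: hs) (i - c).+1) <= z &
    z <= Num.max (nth y (a :: hs) (i - c)) (nth y (a :: hs) (i - c).+1)].
Proof.
have headE (hs0 : seq int) : nth y hs0 0 = head y hs0 by case: hs0.
move: i z; apply: (@path_of_heights_ind (fun c a hs P => forall i z,
  ((i, z) \in vertices_from (c, a) P) =
  [&& (c <= i <= c + size hs)%N,
    Num.min (nth y (a :: hs) (i - c)) (nth y (a :: hs) (i - c).+1) <= z &
    z <= Num.max (nth y (a :: hs) (i - c)) (nth y (a :: hs) (i - c).+1)]))
  => {c a hs}.
- move=> c i z; rewrite inE xpair_eqE /=.
  have [ic|ic|->] := ltngtP i c; rewrite ?andbF /=; [by lia| |by rewrite subnn /=; lia].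
  by lia.
- move=> c h hs IH i z; rewrite /vertices_from /= inE -/(vertices_from _ _) IH xpair_eqE.
  have [ic|ic|->] := ltngtP i c; first by lia.
    by rewrite /= addSnnS; have -> : (i - c = (i - c.+1).+1)%N by lia.
  by rewrite subnn /=; lia.
- move=> c a hs ah IH i z; rewrite /vertices_from /= inE -/(vertices_from _ _) IH xpair_eqE.
  have [ic|ic|->] := ltngtP i c; first by lia.
    by have -> : (i - c = (i - c.+1).+1)%N by lia.
  by rewrite subnn /= headE; lia.
- move=> c a hs ah IH i z; rewrite /vertices_from /= inE -/(vertices_from _ _) IH xpair_eqE.
  have [ic|ic|->] := ltngtP i c; first by lia.
    by have -> : (i - c = (i - c.+1).+1)%N by lia.
  by rewrite subnn /= headE; lia.
Qed.

Lemma uniq_path_of_heights c a hs :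
  uniq (vertices_from (c, a) (path_of_heights a hs)).
Proof.
have headE (hs0 : seq int) : nth y hs0 0 = head y hs0 by case: hs0.
apply: (@path_of_heights_ind (fun c a hs P => uniq (vertices_from (c, a) P)))
  => {c a hs} // [c h hs|c a hs ah|c a hs ah] IH.
- rewrite /vertices_from cons_uniq -/(vertices_from _ _) IH andbT.
  by rewrite vertices_path_of_heights ltnn.
- rewrite /vertices_from cons_uniq -/(vertices_from _ _) IH andbT.
  by rewrite vertices_path_of_heights subnn /= headE; lia.
- rewrite /vertices_from cons_uniq -/(vertices_from _ _) IH andbT.
  by rewrite vertices_path_of_heights subnn /= headE; lia.
Qed.

(** Each column is traversed in one direction, so south steps occur exactly where the leaving height
    is the lower one. *)
Lemma South_path_of_heights c a hs (i : nat) :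
  (exists2 e, e \in edges_from (c, a) (path_of_heights a hs) &
     e.2 = South /\ e.1.1 = i) <->
  (c <= i)%N && (nth y (a :: hs) (i - c).+1 < nth y (a :: hs) (i - c)).
Proof.
have headE (hs0 : seq int) : nth y hs0 0 = head y hs0 by case: hs0.
have consE (e0 : Defs.point * step) (E : seq (Defs.point * step)) :
    (exists2 e, e \in e0 :: E & e.2 = South /\ e.1.1 = i) <->
    (e0.2 = South /\ e0.1.1 = i) \/ (exists2 e, e \in E & e.2 = South /\ e.1.1 = i).
  split=> [[e]|[e0P|[e eE eP]]].
    by rewrite inE => /orP[/eqP -> ?|eE ?]; [left|right; exists e].
    by exists e0; rewrite ?mem_head.
  by exists e; rewrite // inE eE orbT.
apply: (@path_of_heights_ind (fun c a hs P =>
  (exists2 e, e \in edges_from (c, a) P & e.2 = South /\ e.1.1 = i) <->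
  (c <= i)%N && (nth y (a :: hs) (i - c).+1 < nth y (a :: hs) (i - c))))
  => {c a hs}.
- by move=> c; split=> [[] //|]; case: (i - c)%N => [|j] /=; rewrite ?nth_nil ltxx andbF.
- move=> c h hs IH; rewrite /edges_from /= -/(edges_from _ _) consE IH /=.
  have [ic|ic|->] := ltngtP i c; first by lia.
    have -> : (i - c = (i - c.+1).+1)%N by lia.
    by split=> [[[]|]|] //; right.
  by rewrite subnn /= ltxx; split=> [[[]|]|].
- move=> c a hs ah IH; rewrite /edges_from /= -/(edges_from _ _) consE IH /=.
  have [ic|ic|->] := ltngtP i c; first by split=> [[[]|]|].
    have -> : (i - c = (i - c.+1).+1)%N by lia.
    by split=> [[[]|]|] //; right.
  rewrite subnn /= headE; split=> [[[]|]|] //; lia.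
- move=> c a hs ah IH; rewrite /edges_from /= -/(edges_from _ _) consE IH /=.
  have [ic|ic|->] := ltngtP i c.
  + by split=> [[[_ ?]|]|]; lia.
  + have -> : (i - c = (i - c.+1).+1)%N by lia.
    split=> [[[_ ?]|]|] //; first by lia.
    by right.
  + by rewrite subnn /= headE; split=> // _; left.
Qed.

(* A self-avoiding path never turns back within a column, so its east steps
   determine it. *)
Lemma path_of_heightsK p P : uniq (vertices_from p P) ->
  (last p (scanl move p P)).2 = y ->
  P = path_of_heights p.2 (heights_from p P).
Proof.
elim: P p => [|s P IH] [c a] /=; first by move=> _ ->; rewrite /vertical lexx subrr.
move=> /andP[pP uP] /(IH _ uP) PE {IH uP}.
case: s PE pP => /= PE pP.
- rewrite /heights_from /= -/(heights_from _ _).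
  have [ah|ha] := ltP a (head y (heights_from (c, a + 1) P)).
    by rewrite path_of_heights_North // -PE.
  (* Otherwise the remaining path starts with a south step and returns to the initial vertex. *)
  case/negP: pP; rewrite PE path_of_heights_South; last by rewrite ltzD1.
  by rewrite /= addrK !inE eqxx orbT.
- by rewrite /heights_from /= /vertical lexx subrr /=; congr (_ :: _).
- rewrite /heights_from /= -/(heights_from _ _).
  have [ah|ha] := ltP (head y (heights_from (c, a - 1) P)) a.
    by rewrite path_of_heights_South // -PE.
  case/negP: pP; rewrite PE path_of_heights_North; last by rewrite ltrBlDr ltzD1.
  by rewrite /= subrK !inE eqxx orbT.
Qed.

End PathOfHeights.

(** Every step raises a coordinate and none lowers one. *)
Lemma uniq_NE p P : South \notin P -> uniq (vertices_from p P).
Proof.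
elim: P p => // s P IH p; rewrite [South \in _]inE negb_or => /andP[sS NP].
rewrite /vertices_from cons_uniq -/(vertices_from _ _) (IH (move p s)) // andbT.
apply/negP => pP; have := scanl_x_monotone pP; have := scanl_NE_y_monotone NP pP.
by case: s sS {pP} => //=; lia.
Qed.

(** * Boundaries, contacts and noncontacts in terms of heights *)

Section Boundaries.
Variable y : int.
Implicit Types (hs qs : seq int).

(* Index [0] is the origin; indices past the east steps give [y]. *)
Definition height hs (j : nat) : int := nth y (0 :: hs) j.

(** Includes that the first height is nonnegative and the last is at most [y]. *)
Definition nondecreasing_heights hs := forall j, height hs j <= height hs j.+1.

Lemma leq_height hs j k : nondecreasing_heights hs -> (j <= k)%N ->
  height hs j <= height hs k.
Proof. by move=> mono; apply: (homo_leq (@lexx _ _) (@le_trans _ _) mono). Qed.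

Lemma height_default hs j : (size hs < j)%N -> height hs j = y.
Proof. by move=> jx; rewrite /height nth_default. Qed.

Lemma mem_vertices hs (j : nat) (z : int) :
  ((j, z) \in vertices (path_of_heights y 0 hs)) =
  [&& (j <= size hs)%N,
    Num.min (height hs j) (height hs j.+1) <= z &
    z <= Num.max (height hs j) (height hs j.+1)].
Proof.
rewrite -[vertices _]/(vertices_from (0%N, 0) _) vertices_path_of_heights.
by rewrite subn0 add0n leq0n.
Qed.

(** The lowest vertex of the monotone path in column [j] is at [height qs j], so not being strictly
    below is a comparison of heights. *)
Lemma weakly_aboveP hs qs : size hs = size qs -> nondecreasing_heights qs ->
  weakly_above (path_of_heights y 0 hs) (path_of_heights y 0 qs) <->
  forall j, height qs j <= height hs j.
Proof.
move=> sz mono; split=> [/allP above j|qh].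
  have [jx|xj] := leqP j (size hs); last by rewrite !height_default // -sz.
  have /above/andP[+ _] : (j, height hs j) \in vertices (path_of_heights y 0 hs).
    by rewrite mem_vertices jx; lia.
  rewrite /strictly_below negb_and => /orP[/hasPn noQ|].
    have := noQ (j, height qs j); rewrite mem_vertices -sz jx eqxx.
    by move=> /(_ _)/negP[] //; lia.
  case/allPn => -[k w]; rewrite mem_vertices => /and3P[_ + _] /=.
  rewrite negb_imply => + /andP[/eqP kj]; rewrite {k}kj; have := mono j; lia.
apply/allP => -[i z]; rewrite mem_vertices => /and3P[ix lo _].
have qz : height qs i <= z.
  by have := qh i; have := qh i.+1; have := mono i; lia.
have iQ : (i, height qs i) \in vertices (path_of_heights y 0 qs).
  by rewrite mem_vertices -sz ix; have := mono i; lia.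
apply/andP; split; apply/negP => /andP[].
  by move=> _ /allP up; have := up _ iQ; rewrite /= eqxx ltNge qz.
(* A point strictly to the right would share its row with a boundary vertex in an earlier column;
   monotonicity then puts the point on the boundary. *)
case/hasP => -[k w] kQ /eqP wz /allP left; rewrite /= in wz; subst w.
have := left _ kQ; rewrite eqxx /= => ki.
have zi : z = height qs i.
  move: kQ; rewrite mem_vertices => /and3P[_ _].
  by have := leq_height mono ki; have := mono k; lia.
by have := left _ iQ; rewrite -zi eqxx /= ltnn.
Qed.

(** Here the highest boundary vertex in column [j] decides; it is at index [j.+1], hence the shift,
    with index [0] trivial. *)
Lemma weakly_belowP hs qs : size hs = size qs -> nondecreasing_heights qs ->
  weakly_below (path_of_heights y 0 hs) (path_of_heights y 0 qs) <->
  forall j, height hs j <= height qs j.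
Proof.
move=> sz mono; split=> [/allP below [|j]|hq]; first exact: lexx.
  have [jx|xj] := leqP j (size hs); last by rewrite !height_default // -?sz; lia.
  have /below/andP[+ _] : (j, height hs j.+1) \in vertices (path_of_heights y 0 hs).
    by rewrite mem_vertices jx; lia.
  rewrite /strictly_above negb_and => /orP[/hasPn noQ|].
    have := noQ (j, height qs j); rewrite mem_vertices -sz jx eqxx.
    by move=> /(_ _)/negP[] //; lia.
  case/allPn => -[k w]; rewrite mem_vertices => /and3P[_ _ +] /=.
  rewrite negb_imply => + /andP[/eqP kj]; rewrite {k}kj; have := mono j; lia.
apply/allP => -[i z]; rewrite mem_vertices => /and3P[ix _ hi].
have qz : z <= height qs i.+1.
  by have := hq i; have := hq i.+1; have := mono i; lia.
have iQ : (i, height qs i.+1) \in vertices (path_of_heights y 0 qs).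
  by rewrite mem_vertices -sz ix; have := mono i; lia.
apply/andP; split; apply/negP => /andP[].
  by move=> _ /allP up; have := up _ iQ; rewrite /= eqxx ltNge qz.
case/hasP => -[k w] kQ /eqP wz /allP right; rewrite /= in wz; subst w.
have := right _ kQ; rewrite eqxx /= => ik.
have zi : z = height qs i.+1.
  move: kQ; rewrite mem_vertices => /and3P[_ + _].
  by have := leq_height mono ik; have := mono k; lia.
by have := right _ iQ; rewrite -zi eqxx /= ltnn.
Qed.

(** Without south steps the path is self-avoiding, hence determined by its heights, and a drop
    between heights would force a south step. *)
Lemma NE_path_heights (x : nat) Q : NE_path_to x y Q ->
  exists qs, [/\ size qs = x, Q = path_of_heights y 0 qs & nondecreasing_heights qs].
Proof.
case/andP=> NS /eqP eQ.
have QE : Q = path_of_heights y 0 (heights_from origin Q).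
  by apply: (@path_of_heightsK _ origin); [exact: uniq_NE|rewrite -[last _ _]/(endpoint Q) eQ].
exists (heights_from origin Q); split=> //.
  move: eQ; rewrite {1}QE /endpoint -[last _ _]/(last (0%N, 0) (scanl move (0%N, 0) _)).
  by rewrite last_path_of_heights add0n => -[].
move=> j; rewrite leNgt; apply/negP => desc.
have [_] := South_path_of_heights y 0 0 (heights_from origin Q) j.
rewrite subn0 => /(_ desc)[e eQ' [eS _]]; case/negP: NS.
rewrite -QE in eQ'; rewrite -eS.
by have := map_f snd eQ'; rewrite [map _ _]unzip2_zip //= size_scanl leqW.
Qed.

Lemma east_edges_ge c hs e : e \in east_edges c hs -> (c <= e.1.1)%N.
Proof.
elim: hs c => // h hs IH c; rewrite inE => /orP[/eqP -> //|/IH]; exact: ltnW.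
Qed.

Lemma east_edges_cons_head c q qs (h : int) :
  (((c, h), East) \in east_edges c (q :: qs)) = (h == q).
Proof.
rewrite inE !xpair_eqE !eqxx andbT /=; apply: orb_idr => /east_edges_ge /=.
by rewrite ltnn.
Qed.

Lemma east_edges_cons_tail c q qs hs e : e \in east_edges c.+1 hs ->
  (e \in east_edges c (q :: qs)) = (e \in east_edges c.+1 qs).
Proof.
by move=> /east_edges_ge ce; rewrite inE; case: eqP ce => // -> /=; rewrite ltnn.
Qed.

Lemma is_contact_path_of_heights qs e :
  is_contact (path_of_heights y 0 qs) e = (e \in east_edges 0 qs).
Proof. by rewrite -(east_edges_path_of_heights y 0 0) mem_filter. Qed.

(** Both paths have one east step per column, so a shared east step is an equality of heights at the
    same index. *)
Lemma contacts_path_of_heights hs qs : size hs = size qs ->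
  contacts (path_of_heights y 0 qs) (path_of_heights y 0 hs) = matches qs hs.
Proof.
rewrite /contacts (eq_count (is_contact_path_of_heights qs)) => sz.
have -> : count (fun e => e \in east_edges 0 qs) (edges (path_of_heights y 0 hs)) =
    count (fun e => e \in east_edges 0 qs) (east_edges 0 hs).
  rewrite -(east_edges_path_of_heights y 0 0 hs) count_filter.
  apply: eq_count => e /=; apply/esym/andb_idr.
  by rewrite -is_contact_path_of_heights => /andP[].
elim: qs hs 0%N sz => [|q qs IH] [|h hs] c //= [sz].
rewrite east_edges_cons_head /matches /= eq_sym -/(matches _ _) -(IH _ c.+1 sz).
by congr (_ + _)%N; apply: eq_in_count => e eE; rewrite (east_edges_cons_tail _ _ eE).
Qed.

Lemma noncontact_heights_path_of_heights ts bs hs :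
  size ts = size hs -> size bs = size hs ->
  noncontact_heights (path_of_heights y 0 ts) (path_of_heights y 0 bs)
    (path_of_heights y 0 hs) = noncontacts (zip bs ts) hs.
Proof.
move=> st sb; rewrite /noncontact_heights.
rewrite (eq_filter (a2 := predI (fun e => (e \notin east_edges 0 bs) && (e \notin east_edges 0 ts))
    (fun e => e.2 == East))); last first.
  by move=> e /=; rewrite !is_contact_path_of_heights andbC [X in X && _]andbC.
rewrite filter_predI -[edges _]/(edges_from (0%N, 0) _) east_edges_path_of_heights.
elim: hs ts bs 0%N st sb => [|h hs IH] [|t ts] [|b bs] c //= [st] [sb].
rewrite !east_edges_cons_head /noncontacts /=.
have -> : [seq e <- east_edges c.+1 hs |
      (e \notin east_edges c (b :: bs)) && (e \notin east_edges c (t :: ts))] =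
    [seq e <- east_edges c.+1 hs |
      (e \notin east_edges c.+1 bs) && (e \notin east_edges c.+1 ts)].
  by apply: eq_in_filter => e eE; rewrite !(east_edges_cons_tail _ _ eE).
by case: ifP => _ /=; rewrite (IH ts bs).
Qed.

End Boundaries.

(** * From sets of paths to lists of height sequences *)

Lemma descent_set_path_of_heights y hs (D : set nat) :
  descent_set (path_of_heights y 0 hs) = D <->
  forall j, `[< D j >] = (height y hs j.+1 < height y hs j).
Proof.
have desc j : descent_set (path_of_heights y 0 hs) j <->
    height y hs j.+1 < height y hs j.
  by have := South_path_of_heights y 0 0 hs j; rewrite subn0.
split=> [<- j|Dj]; first by apply/asboolP/idP => /desc.
apply/predeqP => j; rewrite desc -Dj; split=> /asboolP //.
Qed.

Section Columns.
Variables (y : int) (bs ts : seq int).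
Hypotheses (sz : size bs = size ts) (bt : forall j, height y bs j <= height y ts j).
Hypotheses (bmono : nondecreasing_heights y bs) (tmono : nondecreasing_heights y ts).

(** The shift by one arises because index [0] of [height] is the origin. *)
Lemma nth_columns j : nth (y, y) (zip bs ts) j = (height y bs j.+1, height y ts j.+1).
Proof. by rewrite nth_zip. Qed.

Lemma good_columns_zip : good_columns y (zip bs ts).
Proof.
split; first by apply/(all_nthP (y, y)) => j _; rewrite nth_columns bt.
have nth_rc j : nth (y, y) (rcons (zip bs ts) (y, y)) j = nth (y, y) (zip bs ts) j.
  rewrite nth_rcons; by case: ltngtP => // jx; rewrite nth_default // ?jx // ltnW.
apply/(sortedP (y, y)) => j _; rewrite !nth_rc !nth_columns /=.
by rewrite bmono tmono.
Qed.

Lemma between_columns hs : size hs = size bs ->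
  all (fun e => e.1.1 <= e.2 <= e.1.2) (zip (zip bs ts) hs) <->
  forall j, height y bs j <= height y hs j <= height y ts j.
Proof.
move=> szh; have szc : size (zip bs ts) = size hs by rewrite size_zip -sz minnn.
split=> [/(all_nthP (y, y, y)) between [|j]|between]; first by rewrite !lexx.
  have [jx|xj] := ltnP j (size hs).
    have := between j; rewrite size_zip szc minnn => /(_ jx).
    by rewrite nth_zip // nth_columns.
  by rewrite !height_default ?lexx // -?sz -?szh ltnS.
apply/(all_nthP (y, y, y)) => j _.
by rewrite nth_zip // nth_columns; exact: between j.+1.
Qed.

End Columns.

(** Abscissa [0] is treated apart: a descent there compares the origin with the first height, while
    [d] in [fillings] starts after the first column. *)
Lemma refined_pathsE (x : nat) (y : int) bs ts (D : set nat) (H : seq int) :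
  size bs = x -> size ts = x -> (forall j, height y bs j <= height y ts j) ->
  nondecreasing_heights y bs -> nondecreasing_heights y ts ->
  refined_paths x y (path_of_heights y 0 ts) (path_of_heights y 0 bs) D H =
  [set` [seq path_of_heights y 0 hs | hs <- fillings y (zip bs ts)
    (fun w => (w < 0) == `[< D 0%N >]) (fun j => `[< D j.+1 >]) H]].
Proof.
move=> sb st bt bmono tmono; have sbt : size bs = size ts by rewrite sb.
have [gc _] := good_columns_zip sbt bt bmono tmono.
have szc : size (zip bs ts) = x by rewrite size_zip sb st minnn.
apply/predeqP => P; split=> [[/and4P[uP /eqP eP PT PB] PD PH]|/mapP[hs]].
  have PE : P = path_of_heights y 0 (heights_from origin P).
    by apply: (@path_of_heightsK y origin); rewrite // -[last _ _]/(endpoint P) eP.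
  move: (heights_from origin P) PE => hs PE; subst P.
  have szh : size hs = x.
    move: eP; rewrite /endpoint -[last _ _]/(last (0%N, 0) (scanl move (0%N, 0) _)).
    by rewrite last_path_of_heights => -[].
  apply/mapP; exists hs => //; apply/mem_fillings => //.
  move/descent_set_path_of_heights: PD => PD.
  split; first by rewrite szc.
  - apply/(between_columns y sbt); rewrite ?sb // => j; apply/andP; split.
      by move: j; apply/weakly_aboveP => //; rewrite sb.
    by move: j; apply/weakly_belowP => //; rewrite st.
  - by rewrite PD /height /=; case: (hs).
  - by move=> j; rewrite PD.
  - by rewrite -PH noncontact_heights_path_of_heights ?szh.
move/mem_fillings => /(_ gc)[szh]; rewrite szc in szh.
move=> /(between_columns y sbt) between q0 desc nc ->.
have {}between := between ltac:(by rewrite sb).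
split; first apply/and4P; first split.
- exact: uniq_path_of_heights.
- rewrite /endpoint -[last _ _]/(last (0%N, 0) (scanl move (0%N, 0) _)).
  by rewrite last_path_of_heights szh.
- by apply/weakly_belowP => //; [rewrite st|move=> j; case/andP: (between j)].
- by apply/weakly_aboveP => //; [rewrite sb|move=> j; case/andP: (between j)].
- apply/descent_set_path_of_heights => -[|j]; last exact: desc.
  by rewrite -(eqP q0) /height /=; case: (hs).
- by rewrite noncontact_heights_path_of_heights ?szh.
Qed.

Lemma sum_refined_paths (x : nat) (y : int) bs ts (D : set nat) (H : seq int)
    (R : comNzRingType) (u v : R) :
  size bs = x -> size ts = x -> (forall j, height y bs j <= height y ts j) ->
  nondecreasing_heights y bs -> nondecreasing_heights y ts ->
  \sum_(P \in refined_paths x y (path_of_heights y 0 ts) (path_of_heights y 0 bs) D H)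
    u ^+ top_contacts (path_of_heights y 0 ts) P *
    v ^+ bottom_contacts (path_of_heights y 0 bs) P =
  gf y u v (zip bs ts) (fun w => (w < 0) == `[< D 0%N >]) (fun j => `[< D j.+1 >]) H.
Proof.
move=> sb st bt bmono tmono; have sbt : size bs = size ts by rewrite sb.
have [gc _] := good_columns_zip sbt bt bmono tmono.
(* The list of paths has no repetition, since [heights_from] inverts [path_of_heights]. *)
rewrite refined_pathsE // -fsbig_seq; last first.
  rewrite map_inj_uniq ?fillings_uniq //.
  exact: can_inj (heights_from_path_of_heights y 0 0).
rewrite big_map; apply: eq_big_seq => hs; move/mem_fillings => /(_ gc)[szh _ _ _ _].
rewrite size_zip sb st minnn in szh.
rewrite /top_contacts /bottom_contacts !contacts_path_of_heights ?szh //.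
by rewrite /weight unzip1_zip ?unzip2_zip ?sb ?st.
Qed.

Theorem theorem3p1 (x y : nat) (T B : lpath)
    (hT : NE_path_to x y T) (hB : NE_path_to x y B) (hTB : weakly_above T B)
    (D : set nat) (H : seq int) (R : comNzRingType) (u v : R) :
  \sum_(P \in refined_paths x y T B D H)
     u ^+ top_contacts T P * v ^+ bottom_contacts B P =
  \sum_(P \in refined_paths x y T B D H)
     u ^+ bottom_contacts B P * v ^+ top_contacts T P.
Proof.
have [ts [st TE tmono]] := NE_path_heights hT.
have [bs [sb BE bmono]] := NE_path_heights hB.
subst T B; have sbt : size bs = size ts by rewrite sb.
have bt j : height y bs j <= height y ts j.
  by move: j; apply/weakly_aboveP.
(* After commuting the factors, the right side is the same generating function with [u] and [v]
   exchanged. *)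
rewrite sum_refined_paths //; under [RHS]eq_fsbigr do rewrite mulrC.
rewrite sum_refined_paths //; apply: gf_symmetric; first exact: good_columns_zip.
(* Monotonicity at index [0] says that the first bottom height is nonnegative. *)
by rewrite -nth0 nth_columns //; exact: bmono 0%N.
Qed.
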